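(* Let $V=T_{p_0}S$ and let $\Theta=\Psi\circ\mathcal A_{E,\mathrm{core}}:S\to Y$ be a core-package-generated observable with values in a finite-dimensional vector space $Y$. Then its response operator satisfies $$D_{p_0}\Theta=D_{\mathcal A_{E,\mathrm{core}}(p_0)}\Psi\circ\mathcal D_{g_0}.$$ Consequently: (1) $\Theta$ is infinitesimally complete at $g_0$ if and only if $D_{\mathcal A_{E,\mathrm{core}}(p_0)}\Psi\circ\mathcal D_{g_0}$ is injective on $V$; (2) no core-package-generated observable, nor any finite family of such observables, can be infinitesimally complete unless $\mathcal D_{g_0}$ is injective; (3) the universal invisible space $\mathcal K_{g_0}=\ker\mathcal D_{g_0}$ is contained in the kernel of every core-package-generated response operator; (4) if the admissible postprocessing differentials separate every nonzero vector of $\operatorname{Im}\mathcal D_{g_0}$ (that is, for every $0\ne Z\in\operatorname{Im}\mathcal D_{g_0}$ there is an admissible postprocessing $\Psi'$ with $D_{\mathcal A_{E,\mathrm{core}}(p_0)}\Psi'(Z)\neq0$), then an element of $V$ is invisible to every admissible core-package-generated observable if and only if it belongs to $\ker\mathcal D_{g_0}$.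
   Context: $S$ is a smooth finite-dimensional manifold parameterizing a smooth family $p\mapsto g_p$ of normalized cohomogeneity-one Einstein metrics ($\operatorname{Ric}(g_p)=\lambda g_p$, $\lambda>0$ fixed, invariant under a fixed Lie group action, normalized by a fixed unit-speed normal geodesic) on a compact manifold $M$, with $g_{p_0}=g_0$ the reference metric. Fixed probe data are given: a compact Riemannian target $(N,h)$ with compatible group action, an equivariant homotopy class of maps $M\to N$ with endpoint, smoothness and normalization conditions, and a reference harmonic map $f_0$ for $g_0$. Under normalized Jacobi nondegeneracy (the linearization at $f_0$ of the tension field in the map variable, between the constrained equivariant $C^{k+2,\alpha}$ and $C^{k,\alpha}$ Hölder spaces, $k\ge4$, $0<\alpha<1$, is an isomorphism) and after shrinking $S$ around $p_0$, each $g_p$ has a unique harmonic map $f_p$ near $f_0$, depending smoothly on $p$; $J_p$ denotes the linearization at $f_p$ of the tension field $f\mapsto\tau_{g_p}(f)$, which is invertible, and $G_p=J_p^{-1}$. The (descended) core analytical package is the smooth map $\mathcal A_{E,\mathrm{core}}:S\to\mathscr X_{\mathrm{core}}$, $p\mapsto(J_p,G_p)$, where (after fixed local trivializations) $\mathscr X_{\mathrm{core}}$ is a Banach manifold of operator data. The universal response differential is $\mathcal D_{g_0}:=D_{p_0}\mathcal A_{E,\mathrm{core}}:V\to T_{\mathcal A_{E,\mathrm{core}}(p_0)}\mathscr X_{\mathrm{core}}$. A smooth map $\Theta:S\to Y$ into a finite-dimensional vector space is a core-package-generated observable if $\Theta=\Psi\circ\mathcal A_{E,\mathrm{core}}$ for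 a smooth map (postprocessing) $\Psi:\mathscr X_{\mathrm{core}}\to Y$; it is admissible if $\Psi$ belongs to a chosen class of admissible finite-dimensional-valued postprocessings. Its response operator is $D_{p_0}\Theta:V\to Y$; $X\in V$ is invisible to $\Theta$ if $D_{p_0}\Theta[X]=0$; $\Theta$ is infinitesimally complete at $g_0$ if $\ker D_{p_0}\Theta=\{0\}$, and a finite family is infinitesimally complete if the kernels of its members' differentials at $p_0$ intersect in $\{0\}$. *)

(* Defs.v *)
From HB Require Import structures.
From mathcomp Require Import all_boot all_order all_algebra.
From mathcomp Require Import boolp classical_sets functions reals topology.
From mathcomp Require Import normedtype derive exp.

Set Implicit Arguments.
Unset Strict Implicit.
Unset Printing Implicit Defensive.

Import Order.TTheory GRing.Theory Num.Theory.
Import numFieldNormedType.Exports.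

Local Open Scope classical_set_scope.
Local Open Scope ring_scope.

Section BoundedOperators.
Context {R : realType}.

Definition bounded_op_pred (V W : normedModType R) : {pred V -> W} :=
  [pred f | `[< linear f /\ exists M, forall x, `|f x| <= M * `|x| >]].

Variables V W : normedModType R.

Record bounded_op := BoundedOp
  { bounded_op_fun :> V -> W ; _ : bounded_op_fun \in @bounded_op_pred V W }.

HB.instance Definition _ := [isSub for bounded_op_fun].
HB.instance Definition _ := gen_eqMixin bounded_op.
HB.instance Definition _ := gen_choiceMixin bounded_op.

Lemma bounded_op_submod_closed : submod_closed (@bounded_op_pred V W).
Proof.
split.
  apply/asboolP; split; first by move=> a x y; rewrite scaler0 addr0.
  by exists 0 => x; rewrite normr0 mul0r.
move=> a f g /asboolP[fl [Mf fM]] /asboolP[gl [Mg gM]].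
apply/asboolP; split.
  move=> b x y; rewrite !fctE /= fl gl !scalerDr !scalerA [a * b]mulrC.
  by rewrite -!addrA; congr (_ + _); rewrite addrCA.
exists (`|a| * Mf + Mg) => x; rewrite !fctE.
rewrite (le_trans (ler_normD _ _))// mulrDl lerD// normrZ -mulrA.
by rewrite ler_wpM2l.
Qed.

HB.instance Definition _ := GRing.isSubmodClosed.Build R (V -> W)
  (@bounded_op_pred V W) bounded_op_submod_closed.
HB.instance Definition _ := [SubChoice_isSubLmodule of bounded_op by <:].

Definition op_norm (f : bounded_op) : R :=
  sup [set `|f x| | x in [set x | `|x| <= 1]].

Lemma bounded_opP (f : bounded_op) :
  linear f /\ exists M, forall x, `|f x| <= M * `|x|.
Proof. by case: f => f /= /asboolP. Qed.

Lemma bounded_op_linear (f : bounded_op) : linear f.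
Proof. by have [] := bounded_opP f. Qed.

Lemma bounded_opZ (f : bounded_op) a x : f (a *: x) = a *: f x.
Proof.
have fl := bounded_op_linear f.
have f0 : f 0 = 0.
  by have := fl (-1) 0 0; rewrite scaler0 addr0 scaleN1r addNr.
by have := fl a x 0; rewrite addr0 f0 addr0.
Qed.

Lemma op_norm_has_sup (f : bounded_op) :
  has_sup [set `|f x| | x in [set x | `|x| <= 1]].
Proof.
split; first by exists `|f 0|, 0 => //=; rewrite normr0.
have [_ [M fM]] := bounded_opP f.
exists `|M| => _ [x /= x1 <-]; apply: (le_trans (fM x)).
apply: (@le_trans _ _ (`|M| * `|x|)); first by rewrite ler_wpM2r// ler_norm.
by rewrite ler_piMr.
Qed.

Lemma op_norm_ub (f : bounded_op) x : `|x| <= 1 -> `|f x| <= op_norm f.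
Proof.
move=> x1; apply: sup_upper_bound; first exact: op_norm_has_sup.
by exists x.
Qed.

Lemma op_normP (f : bounded_op) x : `|f x| <= op_norm f * `|x|.
Proof.
have [->|x0] := eqVneq x 0.
  by rewrite -[X in f X](scale0r (0 : V)) bounded_opZ scale0r !normr0 mulr0.
rewrite -ler_pdivrMr ?normr_gt0//.
have -> : `|f x| / `|x| = `|f (`|x|^-1 *: x)|.
  by rewrite bounded_opZ normrZ normfV normr_id mulrC.
by apply: op_norm_ub; rewrite normrZ normfV normr_id mulVf// normr_eq0.
Qed.

Lemma op_norm_le (f : bounded_op) M :
  (forall x, `|x| <= 1 -> `|f x| <= M) -> op_norm f <= M.
Proof.
move=> fM; apply: ge_sup; first by have [] := op_norm_has_sup f.
by move=> _ [x /= x1 <-]; exact: fM.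
Qed.

Lemma op_normD f g : op_norm (f + g) <= op_norm f + op_norm g.
Proof.
apply: op_norm_le => x x1.
by rewrite (le_trans (ler_normD _ _))// lerD// op_norm_ub.
Qed.

Lemma op_normZ a f : op_norm (a *: f) = `|a| * op_norm f.
Proof.
apply/eqP; rewrite eq_le; apply/andP; split.
  by apply: op_norm_le => x x1; rewrite normrZ ler_wpM2l// op_norm_ub.
have [->|a0] := eqVneq a 0.
  rewrite normr0 mul0r scale0r (le_trans (normr_ge0 ((0 : bounded_op) 0)))//.
  by rewrite op_norm_ub// normr0.
rewrite -ler_pdivlMl ?normr_gt0//; apply: op_norm_le => x x1.
rewrite ler_pdivlMl ?normr_gt0// -normrZ.
exact: (@op_norm_ub (a *: f)).
Qed.

Lemma op_norm_eq0 f : op_norm f = 0 -> f = 0.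
Proof.
move=> f0; apply/val_inj/funext => x /=; apply/eqP; rewrite -normr_le0.
by rewrite (le_trans (op_normP f x))// f0 mul0r.
Qed.

HB.instance Definition _ :=
  Lmodule_isNormed.Build R bounded_op op_normD op_normZ op_norm_eq0.

End BoundedOperators.

Section Smooth.
Context {R : realType}.

(* [Ck n U f]: [f] is of class C^n on the open set [U], derivatives being
   Fréchet derivatives, continuous for the operator norm. *)
Fixpoint Ck (n : nat) (V W : normedModType R) (U : set V) (f : V -> W) : Prop :=
  if n is n'.+1 then
    (forall x, U x -> differentiable f x) /\
    exists Df : V -> bounded_op V W,
      (forall x v, U x -> Df x v = 'd f x v) /\ Ck n' U Df
  else forall x, U x -> {for x, continuous f}.

Definition smooth_on (V W : normedModType R) (U : set V) (f : V -> W) : Prop :=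
  forall n, Ck n U f.

Lemma smooth_on_cst (V W : normedModType R) (U : set V) (w : W) :
  smooth_on U (fun=> w).
Proof.
move=> n; elim: n W w => [|n IHn] W w /=; first by move=> x _; exact: cst_continuous.
split; first by move=> x _; exact: differentiable_cst.
exists (fun=> 0); split; last exact: IHn.
by move=> x v _; rewrite diff_cst.
Qed.

Lemma id_bounded_op (V : normedModType R) : idfun \in @bounded_op_pred R V V.
Proof.
by apply/asboolP; split; [move=> a x y | exists 1 => x; rewrite mul1r].
Qed.

Lemma smooth_on_id (V : normedModType R) (U : set V) : smooth_on U (@idfun V).
Proof.
case=> [|n] /=; first by move=> x _; exact: cvg_id.
split; first by move=> x _; exact: ex_diff.
exists (fun=> BoundedOp (id_bounded_op V)); split; last exact: smooth_on_cst.
by move=> x v _; rewrite diff_val.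
Qed.

End Smooth.

Section Manifolds.
Context {R : realType}.

(* A chart and its inverse are total functions, meaningful on [cdom], resp.
   [cimg], only. *)
Record chart (E : normedModType R) (X : topologicalType) := Chart
  { cdom : set X ; cimg : set E ; cfwd : X -> E ; cbwd : E -> X }.

Record is_chart (E : normedModType R) (X : topologicalType) (c : chart E X)
    : Prop := IsChart {
  open_cdom : open (cdom c) ;
  open_cimg : open (cimg c) ;
  cfwdK : forall x, cdom c x -> cimg c (cfwd c x) /\ cbwd c (cfwd c x) = x ;
  cbwdK : forall y, cimg c y -> cdom c (cbwd c y) /\ cfwd c (cbwd c y) = y ;
  cfwd_continuous : forall x, cdom c x -> {for x, continuous (cfwd c)} ;
  cbwd_continuous : forall y, cimg c y -> {for y, continuous (cbwd c)} }.

(* [chart_at x] is a preferred chart around [x]. It is only used to represent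
   tangent vectors at [x] by elements of the model space. *)
Record manifold (E : normedModType R) := Manifold {
  points :> topologicalType ;
  atlas : set (chart E points) ;
  chart_at : points -> chart E points ;
  points_hausdorff : hausdorff_space points ;
  atlas_chart : forall c, atlas c -> is_chart c ;
  chart_atP : forall x, atlas (chart_at x) /\ cdom (chart_at x) x ;
  transition_smooth : forall c c', atlas c -> atlas c' ->
    smooth_on (cimg c `&` cbwd c @^-1` cdom c') (cfwd c' \o cbwd c) }.

Section Flat.
Variable E : normedModType R.

Let flat_chart : chart E E := Chart setT setT idfun idfun.

Let flat_is_chart (c : chart E E) : [set flat_chart] c -> is_chart c.
Proof.
by move=> ->; split=> //=; [exact: openT|exact: openT|move=> x _; exact: cvg_id|
  move=> x _; exact: cvg_id].
Qed.

Let flat_transition (c c' : chart E E) :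
  [set flat_chart] c -> [set flat_chart] c' ->
  smooth_on (cimg c `&` cbwd c @^-1` cdom c') (cfwd c' \o cbwd c).
Proof. by move=> -> -> /=; exact: smooth_on_id. Qed.

Definition flat : manifold E :=
  @Manifold E E [set flat_chart] (fun=> flat_chart) (@norm_hausdorff _ E)
    flat_is_chart (fun=> conj erefl I) flat_transition.

End Flat.

(* The tangent space at [x] is the model space: [v : tangent x] stands for the
   tangent vector whose coordinates in [chart_at x] are [v]. *)
Definition tangent (E : normedModType R) (X : manifold E) (x : X)
  : normedModType R := E.

Definition tdiff (E F : normedModType R) (X : manifold E) (Y : manifold F)
    (f : X -> Y) (x : X) : tangent x -> tangent (f x) :=
  'd (cfwd (chart_at (f x)) \o f \o cbwd (chart_at x) : E -> F)
     (cfwd (chart_at x) x).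

Definition smooth_map_on (E F : normedModType R) (X : manifold E)
    (Y : manifold F) (A : set X) (f : X -> Y) : Prop :=
  (forall x, A x -> {for x, continuous f}) /\
  forall c d, atlas c -> atlas d ->
    smooth_on (cimg c `&` cbwd c @^-1` (A `&` f @^-1` cdom d))
              (cfwd d \o f \o cbwd c).

Definition smooth_map (E F : normedModType R) (X : manifold E)
    (Y : manifold F) (f : X -> Y) : Prop := smooth_map_on setT f.

Definition smooth_map2_on (E F G : normedModType R) (X : manifold E)
    (Y : manifold F) (Z : manifold G) (A : set (X * Y)) (f : X -> Y -> Z)
    : Prop :=
  (forall z, A z -> {for z, continuous (fun z : X * Y => f z.1 z.2)}) /\
  forall a b c, atlas a -> atlas b -> atlas c ->
    smooth_on [set z : E * F | [/\ cimg a z.1, cimg b z.2,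
                 A (cbwd a z.1, cbwd b z.2)
               & cdom c (f (cbwd a z.1) (cbwd b z.2))]]
              (fun z : E * F => cfwd c (f (cbwd a z.1) (cbwd b z.2))).

Definition smooth_map2 (E F G : normedModType R) (X : manifold E)
    (Y : manifold F) (Z : manifold G) (f : X -> Y -> Z) : Prop :=
  smooth_map2_on setT f.

End Manifolds.

Arguments tdiff {R E F X Y} f x _.

Section LieGroups.
Context {R : realType}.

Record lie_group (k : nat) := LieGroup {
  lie_points :> manifold 'rV[R]_k ;
  lmul : lie_points -> lie_points -> lie_points ;
  lone : lie_points ;
  linv : lie_points -> lie_points ;
  lmulA : forall a b c, lmul a (lmul b c) = lmul (lmul a b) c ;
  lmul1 : forall a, lmul lone a = a ;
  lmulV : forall a, lmul (linv a) a = lone ;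
  lie_second_countable : @second_countable lie_points ;
  lmul_smooth : smooth_map2 lmul ;
  linv_smooth : smooth_map linv }.

Record smooth_action (k : nat) (K : lie_group k) (E : normedModType R)
    (X : manifold E) := SmoothAction {
  act :> K -> X -> X ;
  act1 : forall x, act (lone K) x = x ;
  actM : forall a b x, act (lmul a b) x = act a (act b x) ;
  act_smooth : smooth_map2 act }.

Definition equivariant (k : nat) (K : lie_group k) (E F : normedModType R)
    (X : manifold E) (Y : manifold F) (aX : smooth_action K X)
    (aY : smooth_action K Y) (f : X -> Y) : Prop :=
  forall a x, f (aX a x) = aY a (f x).

Section Orbits.
Variables (k m : nat) (K : lie_group k) (M : manifold 'rV[R]_m).
Variable aM : smooth_action K M.

(* The infinitesimal action at [x], whose image is the tangent space of the
   orbit of [x]. *)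
Definition orbit_map_diff (x : M) : 'M[R]_(k, m) :=
  lin1_mx (tdiff (fun a => aM a x) (lone K) : 'rV[R]_k -> 'rV[R]_m).

(* The orbits are closed, and the largest ones are hypersurfaces. *)
Definition cohomogeneity_one : Prop :=
  [/\ forall x, closed (range (aM ^~ x)),
      forall x, (\rank (orbit_map_diff x) < m)%N
    & exists x, (\rank (orbit_map_diff x)).+1 = m].

End Orbits.
End LieGroups.

Section Riemann.
Context {R : realType}.

Definition pderiv (m : nat) (W : normedModType R) (i : 'I_m)
    (f : 'rV[R]_m -> W) : 'rV[R]_m -> W :=
  'D_(delta_mx 0 i) f.

Section Coordinates.
Variables (m : nat) (G : 'rV[R]_m -> 'M[R]_m).

Let dG l i j y : R := pderiv l (fun z => G z i j) y.

(* The Christoffel symbol Gamma^k_ij of the metric with coefficients [G]. *)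
Definition christoffel (k i j : 'I_m) (y : 'rV[R]_m) : R :=
  2^-1 * \sum_l invmx (G y) k l * (dG i l j y + dG j i l y - dG l i j y).

Definition ricci (i j : 'I_m) (y : 'rV[R]_m) : R :=
  \sum_k (pderiv k (christoffel k i j) y - pderiv j (christoffel k i k) y)
  + \sum_k \sum_l (christoffel k k l y * christoffel l i j y
                   - christoffel k j l y * christoffel l i k y).

End Coordinates.

Section Metrics.
Variables (m : nat) (M : manifold 'rV[R]_m).

(* [g x] is the Gram matrix of the metric in the coordinates of [chart_at x]. *)
Definition metric := M -> 'M[R]_m.

Implicit Type g : metric.

Definition inner g (x : M) (v w : tangent x) : R :=
  ((v : 'rV[R]_m) *m g x *m (w : 'rV[R]_m)^T) 0 0.

(* The coefficients of the metric in the chart [c]. *)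
Definition metric_coord g (c : chart 'rV[R]_m M) (y : 'rV[R]_m) : 'M[R]_m :=
  let x := cbwd c y in
  let P := jacobian (cfwd (chart_at x) \o cbwd c) y in
  P *m g x *m P^T.

Definition riemannian g : Prop :=
  [/\ forall x, (g x)^T = g x,
      forall x (v : tangent x), v != 0 -> 0 < inner g v v
    & forall c, atlas c -> smooth_on (cimg c) (metric_coord g c)].

Definition einstein (lam : R) g : Prop :=
  forall c, atlas c -> forall y, cimg c y ->
  forall i j, ricci (metric_coord g c) i j y = lam * metric_coord g c y i j.

Definition isometric_action k (K : lie_group k) (aM : smooth_action K M) g
    : Prop :=
  forall a x (v w : tangent x),
    inner g (tdiff (aM a) x v) (tdiff (aM a) x w) = inner g v w.

Definition velocity (c : flat R -> M) (t : R) : tangent (c t) :=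
  tdiff c t (1 : R).

Definition geodesic g (c : flat R -> M) : Prop :=
  smooth_map c /\
  forall d t, atlas d -> cdom d (c t) ->
  let x k : R -> R := fun s => cfwd d (c s) 0 k in
  forall k, derive1 (derive1 (x k)) t +
    \sum_i \sum_j christoffel (metric_coord g d) k i j (cfwd d (c t))
                  * derive1 (x i) t * derive1 (x j) t = 0.

Definition unit_speed_normal_geodesic k (K : lie_group k)
    (aM : smooth_action K M) g (c : flat R -> M) : Prop :=
  [/\ geodesic g c,
      forall t, inner g (velocity c t) (velocity c t) = 1
    & forall t (xi : 'rV[R]_k),
        inner g (velocity c t) (xi *m orbit_map_diff aM (c t)) = 0].

End Metrics.

Section Tension.
Variables (m n : nat) (M : manifold 'rV[R]_m) (N : manifold 'rV[R]_n).

(* The tension field trace_g (nabla df) of [f], at [x]. *)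
Definition tension (g : metric M) (h : metric N) (f : M -> N) (x : M)
    : tangent (f x) :=
  let c := chart_at x in
  let d := chart_at (f x) in
  let G := metric_coord g c in
  let H := metric_coord h d in
  let y := cfwd c x in
  let u (a : 'I_n) : 'rV[R]_m -> R := fun z => cfwd d (f (cbwd c z)) 0 a in
  \row_a \sum_i \sum_j invmx (G y) i j *
    (pderiv i (pderiv j (u a)) y
     - \sum_k christoffel G k i j y * pderiv k (u a) y
     + \sum_b \sum_b' christoffel H a b b' (cfwd d (f x))
                      * pderiv i (u b) y * pderiv j (u b') y).

Definition harmonic (g : metric M) (h : metric N) (f : M -> N) : Prop :=
  forall x, tension g h f x = 0.

End Tension.
End Riemann.

Section Hoelder.
Context {R : realType}.

Fixpoint iter_pderiv (m : nat) (W : normedModType R) (s : seq 'I_m)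
    (f : 'rV[R]_m -> W) : 'rV[R]_m -> W :=
  if s is i :: s' then pderiv i (iter_pderiv s' f) else f.

(* [B] bounds the C^{k,al} norm of [f] on [K]. *)
Definition hoelder_bound (m : nat) (W : normedModType R) (k : nat) (al : R)
    (K : set 'rV[R]_m) (f : 'rV[R]_m -> W) (B : R) : Prop :=
  (forall s x, (size s <= k)%N -> K x -> `|iter_pderiv s f x| <= B) /\
  (forall s x y, size s = k -> K x -> K y ->
     `|iter_pderiv s f x - iter_pderiv s f y| <= B * `|x - y| `^ al).

Variables (m n : nat) (M : manifold 'rV[R]_m) (N : manifold 'rV[R]_n).

Definition chart_overlap (f : M -> N) (c : chart 'rV[R]_m M)
    (d : chart 'rV[R]_n N) : set 'rV[R]_m :=
  cimg c `&` cbwd c @^-1` (f @^-1` cdom d).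

Definition map_coord (f : M -> N) (c : chart 'rV[R]_m M)
    (d : chart 'rV[R]_n N) : 'rV[R]_m -> 'rV[R]_n :=
  cfwd d \o f \o cbwd c.

(* Sections of the pullback bundle f^*TN. *)
Definition vfield (f : M -> N) := forall x : M, tangent (f x).

Definition vfield_coord (f : M -> N) (s : vfield f) (c : chart 'rV[R]_m M)
    (d : chart 'rV[R]_n N) (y : 'rV[R]_m) : 'rV[R]_n :=
  let x := cbwd c y in
  let d0 := chart_at (f x) in
  'd (cfwd d \o cbwd d0 : 'rV[R]_n -> 'rV[R]_n) (cfwd d0 (f x)) (s x).

(* [u c d], defined on [chart_overlap f c d], is of class C^{k,al} locally. *)
Definition hoelder_class (k : nat) (al : R) (f : M -> N)
    (u : chart 'rV[R]_m M -> chart 'rV[R]_n N -> 'rV[R]_m -> 'rV[R]_n) : Prop :=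
  forall c d, atlas c -> atlas d ->
    Ck k (chart_overlap f c d) (u c d) /\
    forall K, compact K -> K `<=` chart_overlap f c d ->
      exists B, hoelder_bound k al K (u c d) B.

Definition hoelder_map (k : nat) (al : R) (f : M -> N) : Prop :=
  continuous f /\ hoelder_class k al f (map_coord f).

Definition hoelder_vfield (k : nat) (al : R) (f : M -> N) (s : vfield f)
    : Prop :=
  hoelder_class k al f (vfield_coord s).

(* A finite family of coordinate domains used to measure C^{k,al} norms. *)
Record hoelder_cover (f : M -> N) := HoelderCover {
  cover_size : nat ;
  cover_dom : 'I_cover_size -> chart 'rV[R]_m M ;
  cover_set : 'I_cover_size -> set 'rV[R]_m ;
  cover_cod : 'I_cover_size -> chart 'rV[R]_n N ;
  cover_atlas : forall i, atlas (cover_dom i) /\ atlas (cover_cod i) ;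
  cover_compact : forall i, compact (cover_set i) ;
  cover_overlap : forall i,
    cover_set i `<=` chart_overlap f (cover_dom i) (cover_cod i) ;
  cover_full : forall x, exists i,
    cdom (cover_dom i) x /\ (cover_set i)° (cfwd (cover_dom i) x) }.

Arguments cover_dom {f} _ _.
Arguments cover_set {f} _ _.
Arguments cover_cod {f} _ _.

Definition vfield_norm_le (f : M -> N) (cov : hoelder_cover f) (k : nat)
    (al : R) (s : vfield f) (B : R) : Prop :=
  forall i, hoelder_bound k al (cover_set cov i)
              (vfield_coord s (cover_dom cov i) (cover_cod cov i)) B.

(* [f'] is at C^{k,al} distance at most [B] of [f]. *)
Definition map_dist_le (f : M -> N) (cov : hoelder_cover f) (k : nat)
    (al : R) (f' : M -> N) (B : R) : Prop :=
  forall i, let c := cover_dom cov i in let d := cover_cod cov i in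
    cover_set cov i `<=` chart_overlap f' c d /\
    hoelder_bound k al (cover_set cov i)
      (fun y => map_coord f' c d y - map_coord f c d y) B.

Section Equivariance.
Variables (k : nat) (K : @lie_group R k).
Variables (aM : smooth_action K M) (aN : smooth_action K N).

Definition equivariant_vfield (f : M -> N) (s : vfield f) : Prop :=
  forall a x, s (aM a x) = tdiff (aN a) (f x) (s x) :> 'rV[R]_n.

Definition equivariantly_homotopic (f f' : M -> N) : Prop :=
  exists H : R * M -> N,
    [/\ {within [set z | 0 <= z.1 <= 1], continuous H},
        forall t, 0 <= t <= 1 -> equivariant aM aN (fun x => H (t, x)),
        forall x, H (0, x) = f x
      & forall x, H (1, x) = f' x].

(* [ev] presents the Banach space [E] as the space of the equivariant sections
   of f^*TN of class C^{l,al} satisfying [cond], with a norm equivalent to the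
   C^{l,al} norm. *)
Definition hoelder_space (f : M -> N) (cov : hoelder_cover f) (l : nat)
    (al : R) (cond : set (vfield f)) (E : completeNormedModType R)
    (ev : E -> vfield f) : Prop :=
  [/\ forall (a : R) e e' x, ev (a *: e + e') x = a *: ev e x + ev e' x,
      forall s, range ev s <->
        [/\ hoelder_vfield l al s, equivariant_vfield s & cond s]
    & exists2 C : R, 0 < C & forall e,
        vfield_norm_le cov l al (ev e) (C * `|e|) /\
        forall B, vfield_norm_le cov l al (ev e) B -> `|e| <= C * B].

End Equivariance.
End Hoelder.

Section Package.
Context {R : realType}.

Record einstein_family := EinsteinFamily {
  dimM : nat ; dimK : nat ; dimS : nat ;
  src : manifold 'rV[R]_dimM ;
  grp : @lie_group R dimK ;
  src_act : smooth_action grp src ;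
  par : manifold 'rV[R]_dimS ;
  par0 : par ;
  fam : par -> metric src ;
  einstein_const : R ;
  normal_geodesic : flat R -> src ;
  src_compact : compact [set: src] ;
  par_second_countable : @second_countable par ;
  einstein_const_gt0 : 0 < einstein_const ;
  src_cohomogeneity_one : cohomogeneity_one src_act ;
  fam_riemannian : forall p, riemannian (fam p) ;
  fam_smooth : forall a c, atlas a -> atlas c ->
    smooth_on [set z : 'rV[R]_dimS * 'rV[R]_dimM | cimg a z.1 /\ cimg c z.2]
              (fun z => metric_coord (fam (cbwd a z.1)) c z.2) ;
  fam_einstein : forall p, einstein einstein_const (fam p) ;
  fam_invariant : forall p, isometric_action src_act (fam p) ;
  fam_normalized : forall p,
    unit_speed_normal_geodesic src_act (fam p) normal_geodesic }.

(* [probe_cond] stands for the endpoint, smoothness and normalization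
   conditions imposed on maps in the equivariant homotopy class of
   [ref_map]. *)
Record probe (S : einstein_family) := Probe {
  dimN : nat ;
  tgt : manifold 'rV[R]_dimN ;
  tgt_metric : metric tgt ;
  tgt_act : smooth_action (grp S) tgt ;
  hoelder_order : nat ;
  hoelder_exp : R ;
  probe_cond : set (src S -> tgt) ;
  ref_map : src S -> tgt ;
  tgt_compact : compact [set: tgt] ;
  tgt_riemannian : riemannian tgt_metric ;
  tgt_isometric : isometric_action tgt_act tgt_metric ;
  hoelder_order_ge4 : (4 <= hoelder_order)%N ;
  hoelder_exp_itv : 0 < hoelder_exp < 1 ;
  ref_map_hoelder : hoelder_map hoelder_order.+2 hoelder_exp ref_map ;
  ref_map_equivariant : equivariant (src_act S) tgt_act ref_map ;
  ref_map_cond : probe_cond ref_map ;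
  ref_map_harmonic : harmonic (fam (par0 S)) tgt_metric ref_map }.

Arguments probe_cond {S} _ _.
Arguments ref_map {S} _ _.
Arguments tgt_metric {S} _ _.

Definition probe_map (S : einstein_family) (P : probe S)
    (f : src S -> tgt P) : Prop :=
  [/\ hoelder_map (hoelder_order P).+2 (hoelder_exp P) f,
      equivariant (src_act S) (tgt_act P) f,
      equivariantly_homotopic (src_act S) (tgt_act P) (ref_map P) f
    & probe_cond P f].

(* The local trivializations around [ref_map]: a chart [near_map] of the space
   of probe maps, modelled on the Banach space [dom_space] of constrained
   C^{k+2,al} fields, and fibrewise isomorphisms [transport w], written in the
   preferred charts and acting on row vectors on the right, which identify the
   C^{k,al} fields along [near_map w] with fields along [ref_map]. In them
   the tension field becomes the map [tension_op] between Banach spaces. *)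
Record trivialization (S : einstein_family) (P : probe S) := Trivialization {
  cover : hoelder_cover (ref_map P) ;
  dom_cond : set (vfield (ref_map P)) ;
  cod_cond : set (vfield (ref_map P)) ;
  dom_space : completeNormedModType R ;
  cod_space : completeNormedModType R ;
  dom_field : dom_space -> vfield (ref_map P) ;
  cod_field : cod_space -> vfield (ref_map P) ;
  dom_fieldP : hoelder_space (src_act S) (tgt_act P) cover
    (hoelder_order P).+2 (hoelder_exp P) dom_cond dom_field ;
  cod_fieldP : hoelder_space (src_act S) (tgt_act P) cover
    (hoelder_order P) (hoelder_exp P) cod_cond cod_field ;
  near0 : set dom_space ;
  near_map : flat dom_space -> src S -> tgt P ;
  near0_open : open near0 ;
  near0_0 : near0 0 ;
  near_map0 : near_map 0 = ref_map P ;
  near_map_probe : forall w, near0 w -> probe_map (near_map w) ;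
  near_map_inj : forall w w', near0 w -> near0 w' ->
    near_map w = near_map w' -> w = w' ;
  near_map_onto : exists2 e : R, 0 < e & forall f, probe_map f ->
    map_dist_le cover (hoelder_order P).+2 (hoelder_exp P) f e ->
    exists2 w, near0 w & near_map w = f ;
  near_map_continuous : forall e : R, 0 < e ->
    \forall w \near (0 : dom_space),
      map_dist_le cover (hoelder_order P).+2 (hoelder_exp P) (near_map w) e ;
  near_map_smooth : forall x, smooth_map_on (near0 : set (flat dom_space)) (near_map ^~ x) ;
  near_map_diff0 : forall x e,
    tdiff (near_map ^~ x) (0 : dom_space) e = dom_field e x :> 'rV[R]_(dimN P) ;
  near_map_diff : forall w, near0 w -> forall e,
    let s : vfield (near_map w) := fun x => tdiff (near_map ^~ x) w e in
    hoelder_vfield (hoelder_order P).+2 (hoelder_exp P) s /\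
    ((forall x, s x = 0) -> e = 0) ;
  transport : dom_space -> src S -> 'M[R]_(dimN P) ;
  transport0 : forall x, transport 0 x = 1%:M ;
  transport_unit : forall w x, near0 w -> transport w x \in unitmx ;
  transport_smooth : forall x d, atlas d ->
    smooth_on (near0 `&` [set w | cdom d (near_map w x)])
      (fun w => let z := near_map w x in
         jacobian (cfwd (chart_at z) \o cbwd d) (cfwd d z) *m transport w x) ;
  transport_hoelder : forall w, near0 w -> forall s : vfield (near_map w),
    let s' : vfield (ref_map P) :=
      fun x => (s x : 'rV[R]_(dimN P)) *m transport w x in
    (hoelder_vfield (hoelder_order P) (hoelder_exp P) s /\
     equivariant_vfield (src_act S) (tgt_act P) s) <->
    (hoelder_vfield (hoelder_order P) (hoelder_exp P) s' /\
     equivariant_vfield (src_act S) (tgt_act P) s') ;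
  tension_op : par S -> flat dom_space -> flat cod_space ;
  tension_opE : forall p w, near0 w -> forall x,
    cod_field (tension_op p w) x =
    (tension (fam p) (tgt_metric P) (near_map w) x : 'rV[R]_(dimN P))
      *m transport w x ;
  tension_op_smooth :
    smooth_map2_on [set z : par S * flat dom_space | near0 z.2] tension_op }.

Arguments near0 {S P} _ _.
Arguments near_map {S P} _ _ _.
Arguments tension_op {S P} _ _ _.

(* The harmonic maps [near_map (sol p)] for [fam p], the linearizations
   [jacobi p] of the tension field at these maps, and their inverses
   [green p]. At [par0], the existence of [green] is the normalized Jacobi
   nondegeneracy of [ref_map]. *)
Record harmonic_family (S : einstein_family) (P : probe S)
    (T : trivialization P) := HarmonicFamily {
  sol : par S -> flat (dom_space T) ;
  jacobi : par S -> bounded_op (dom_space T) (cod_space T) ;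
  green : par S -> bounded_op (cod_space T) (dom_space T) ;
  sol_near0 : forall p, near0 T (sol p) ;
  sol_par0 : sol (par0 S) = 0 ;
  sol_harmonic : forall p,
    harmonic (fam p) (tgt_metric P) (near_map T (sol p)) ;
  sol_unique : forall p w, near0 T w ->
    harmonic (fam p) (tgt_metric P) (near_map T w) -> w = sol p ;
  sol_smooth : smooth_map sol ;
  jacobiE : forall p e,
    jacobi p e = 'd (tension_op T p : dom_space T -> cod_space T) (sol p) e ;
  jacobiK : forall p, cancel (jacobi p) (green p) ;
  greenK : forall p, cancel (green p) (jacobi p) }.

Arguments jacobi {S P T} _ _.
Arguments green {S P T} _ _.

(* The Banach manifold [core] of operator data, whose points are determined by
   the pair of operators [core_ops], and the smooth map [core_map] which sends
   [p] to (J_p, G_p). *)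
Record core_package (S : einstein_family) (P : probe S)
    (T : trivialization P) (H : harmonic_family T) := CorePackage {
  core_model : completeNormedModType R ;
  core : manifold core_model ;
  core_ops : core ->
    flat (bounded_op (dom_space T) (cod_space T) *
          bounded_op (cod_space T) (dom_space T))%type ;
  core_map : par S -> core ;
  core_ops_smooth : smooth_map core_ops ;
  core_ops_inj : injective core_ops ;
  core_ops_immersion : forall x : core, injective (tdiff core_ops x) ;
  core_mapE : forall p, core_ops (core_map p) = (jacobi H p, green H p) ;
  core_map_smooth : smooth_map core_map }.

End Package.

Arguments core_map {R S P T H} _ _.
Arguments core {R S P T H} _.

Arguments einstein_family : clear implicits.

Record fin_dim_space (R : realType) := FinDimSpace {
  fin_dim_sort :> normedModType R ;
  fin_dimP : exists n (b : 'I_n -> fin_dim_sort),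
    forall y, exists c : 'I_n -> R, y = \sum_i c i *: b i }.

Section Observables.
Context {R : realType} {S : einstein_family R} {P : probe S}.
Context {T : trivialization P} {H : harmonic_family T} (C : core_package H).

Definition universal_response :
    tangent (par0 S) -> tangent (core_map C (par0 S)) :=
  tdiff (core_map C) (par0 S).

Definition universal_invisible : set (tangent (par0 S)) :=
  [set v | universal_response v = 0].

Definition postprocessing (Y : fin_dim_space R) (Psi : core C -> Y) : Prop :=
  smooth_map (Psi : core C -> flat Y).

Definition post_diff (Y : fin_dim_space R) (Psi : core C -> Y) :
    tangent (core_map C (par0 S)) -> Y :=
  tdiff (Psi : core C -> flat Y) (core_map C (par0 S)).

Definition core_generated (Y : fin_dim_space R) (Theta : par S -> Y) : Prop :=
  exists2 Psi : core C -> Y, postprocessing Psi & Theta = Psi \o core_map C.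

Definition admissible_observable
    (adm : forall Y : fin_dim_space R, set (core C -> Y))
    (Y : fin_dim_space R) (Theta : par S -> Y) : Prop :=
  exists2 Psi : core C -> Y, adm Y Psi & Theta = Psi \o core_map C.

Definition response (Y : fin_dim_space R) (Theta : par S -> Y) :
    tangent (par0 S) -> Y :=
  tdiff (Theta : par S -> flat Y) (par0 S).

Definition invisible (Y : fin_dim_space R) (Theta : par S -> Y)
    (v : tangent (par0 S)) : Prop :=
  response Theta v = 0.

Definition infinitesimally_complete (Y : fin_dim_space R)
    (Theta : par S -> Y) : Prop :=
  [set v | response Theta v = 0] = [set 0].

Definition family_infinitesimally_complete (n : nat)
    (Y : 'I_n -> fin_dim_space R) (Theta : forall i, par S -> Y i) : Prop :=
  \bigcap_(i in [set: 'I_n]) [set v | response (Theta i) v = 0] = [set 0].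

End Observables.

(* Main.v *)
(* Everything follows from the chain rule for [tdiff]. Charts are total
   functions inverse to each other on their domains only, so the coordinate
   expression of [g \o f] agrees with the composite of those of [g] and [f]
   merely near the base point; hence the need for [near_eq_diff]. *)
Require Import Defs.
From mathcomp Require Import all_boot all_order all_algebra.
From mathcomp Require Import boolp classical_sets functions reals topology.
From mathcomp Require Import normedtype landau derive.

Import Order.TTheory GRing.Theory Num.Theory.
Import numFieldNormedType.Exports.

Local Open Scope classical_set_scope.
Local Open Scope ring_scope.

(** A differential is the only continuous linear map giving a first-order expansion, and such an
    expansion depends only on the germ at [x]; so the one for [f] serves for [g]. *)
Lemma near_eq_diff {R : realType} {V W : normedModType R} (f g : V -> W)
    (x : V) :
  (\forall y \near x, f y = g y) -> differentiable f x ->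
  'd g x = 'd f x :> (V -> W).
Proof.
move=> fg df; apply: diff_unique; first exact: diff_continuous.
have fgx : f x = g x by exact: nbhs_singleton fg.
have /eqaddoP dfo := diff_locally df.
apply/eqaddoP => e e0.
near=> h.
have fgh : f (h + x) = g (h + x).
  near: h.
  (* The expansion is in the increment [h] near 0, while [fg] holds near [x]: the translation by [x]
     carries one filter to the other. *)
  have /= c : (fun h => h + x) @ (0 : V) --> x.
    rewrite -[X in _ --> X]add0r.
    by apply: cvgD; [exact: cvg_id|exact: cvg_cst].
  exact: c _ fg.
rewrite -[X in `|X| <= _]/(g (h + x) - (g x + 'd f x h)) -fgx -fgh.
by near: h; exact: dfo.
Unshelve. all: by end_near.
Qed.

Lemma smooth_map_differentiable {R : realType} {E F : normedModType R}
    {X : manifold E} {Y : manifold F} (f : X -> Y) (x : X) :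
  smooth_map f ->
  differentiable (cfwd (chart_at (f x)) \o f \o cbwd (chart_at x) : E -> F)
    (cfwd (chart_at x) x).
Proof.
have [ax xdom] := chart_atP x; have [afx fxdom] := chart_atP (f x).
have [imx bfx] := cfwdK (atlas_chart ax) xdom.
(* Class C^1 in the two preferred charts already contains differentiability. *)
move=> [_ /(_ _ _ ax afx 1%N)[+ _]]; apply; split=> //=.
by rewrite bfx.
Qed.

Lemma tdiff_comp {R : realType} {E F G : normedModType R} {X : manifold E}
    {Y : manifold F} {Z : manifold G} (f : X -> Y) (g : Y -> Z) (x : X) :
  smooth_map f -> smooth_map g ->
  tdiff (g \o f) x = tdiff g (f x) \o tdiff f x.
Proof.
move=> fS gS.
have [ax xdom] := chart_atP x; have [afx fxdom] := chart_atP (f x).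
have [imx bfx] := cfwdK (atlas_chart ax) xdom.
pose f' := cfwd (chart_at (f x)) \o f \o cbwd (chart_at x) : E -> F.
pose g' := cfwd (chart_at (g (f x))) \o g \o cbwd (chart_at (f x)) : F -> G.
have f'x : f' (cfwd (chart_at x) x) = cfwd (chart_at (f x)) (f x).
  by rewrite /f' /= bfx.
have df' : differentiable f' (cfwd (chart_at x) x).
  exact: smooth_map_differentiable.
have dg' : differentiable g' (f' (cfwd (chart_at x) x)).
  by rewrite f'x; exact: smooth_map_differentiable.
(* The vector-space chain rule merges the right side into one differential, of a function with the
   same germ as the coordinate expression of [g \o f]. *)
rewrite [RHS](_ : _ = 'd (g' \o f') (cfwd (chart_at x) x) :> (E -> G)); last first.
  by rewrite diff_comp// f'x.
apply: near_eq_diff; last exact: differentiable_comp.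
(* Continuity of [f] keeps nearby points in the chart domain at [f x], where the inserted
   [cbwd \o cfwd] cancels. *)
have fb : f \o cbwd (chart_at x) @ cfwd (chart_at x) x --> f x.
  have := cbwd_continuous (atlas_chart ax) imx.
  rewrite /prop_for /continuous_at bfx => /cvg_comp; apply.
  exact: fS.1.
have fxn : nbhs (f x) (cdom (chart_at (f x))).
  exact: open_nbhs_nbhs (conj (open_cdom (atlas_chart afx)) fxdom).
have := fb _ fxn; rewrite /nbhs /=; apply: filterS => y fy.
by rewrite /g' /f' /= (cfwdK (atlas_chart afx) fy).2.
Qed.

(** ['d] is a linear map by construction, even at points of non-differentiability, so [f] can be
    arbitrary. *)
Lemma tdiff0 {R : realType} {E F : normedModType R} {X : manifold E}
    {Y : manifold F} (f : X -> Y) (x : X) :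
  tdiff f x (0 : E) = 0 :> F.
Proof. exact: linear0. Qed.

Lemma tdiffB {R : realType} {E F : normedModType R} {X : manifold E}
    {Y : manifold F} (f : X -> Y) (x : X) (v w : E) :
  tdiff f x (v - w) = tdiff f x v - tdiff f x w :> F.
Proof. exact: linearB. Qed.

(** Bridges completeness, stated through kernels, and injectivity: equal images put [v - w] in the
    kernel. *)
Lemma ker_tdiff_injective {R : realType} {E F : normedModType R}
    {X : manifold E} {Y : manifold F} (f : X -> Y) (x : X) :
  (forall v : E, tdiff f x v = 0 :> F -> v = 0) -> injective (tdiff f x).
Proof.
move=> f0 v w vw; apply/eqP; rewrite -(subr_eq0 (v : E)); apply/eqP/f0.
by rewrite tdiffB vw subrr.
Qed.

Lemma response_comp {R : realType} {S : einstein_family R} {P : probe S}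
    {T : trivialization P} {H : harmonic_family T} {C : core_package H}
    {Y : fin_dim_space R} {Psi : core C -> Y} :
  postprocessing Psi ->
  response (Psi \o core_map C) = post_diff Psi \o universal_response C.
Proof. by move=> PsiS; exact: tdiff_comp (core_map_smooth C) PsiS. Qed.

(** The response factors through [universal_response], and the linear outer factor sends 0 to 0. *)
Lemma universal_invisible_sub {R : realType} {S : einstein_family R}
    {P : probe S} {T : trivialization P} {H : harmonic_family T}
    {C : core_package H} {Y : fin_dim_space R} {Theta : par S -> Y} :
  core_generated C Theta ->
  universal_invisible C `<=` [set v | response Theta v = 0].
Proof.
move=> [Psi PsiS ->] v /= v0; rewrite response_comp//= v0.
exact: tdiff0.
Qed.

Theorem theorem6p1 (R : realType) (S : einstein_family R) (P : probe S)
    (T : trivialization P) (H : harmonic_family T) (C : core_package H)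
    (adm : forall Y : fin_dim_space R, set (core C -> Y))
    (adm_post : forall (Y : fin_dim_space R) (Psi : core C -> Y),
       adm Y Psi -> postprocessing Psi) :
  (forall (Y : fin_dim_space R) (Psi : core C -> Y) (Theta : par S -> Y),
     postprocessing Psi -> Theta = Psi \o core_map C ->
     response Theta = post_diff Psi \o universal_response C /\
     (infinitesimally_complete Theta <->
      injective (post_diff Psi \o universal_response C))) /\
  (forall (Y : fin_dim_space R) (Theta : par S -> Y),
     core_generated C Theta -> infinitesimally_complete Theta ->
     injective (universal_response C)) /\
  (forall (n : nat) (Y : 'I_n -> fin_dim_space R)
      (Theta : forall i, par S -> Y i),
     (forall i, core_generated C (Theta i)) ->
     family_infinitesimally_complete Theta ->
     injective (universal_response C)) /\
  (forall (Y : fin_dim_space R) (Theta : par S -> Y),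
     core_generated C Theta ->
     universal_invisible C `<=` [set v | response Theta v = 0]) /\
  ((forall Z : tangent (core_map C (par0 S)),
      range (universal_response C) Z -> Z <> 0 ->
      exists (Y : fin_dim_space R) (Psi : core C -> Y),
        adm Y Psi /\ post_diff Psi Z <> 0) ->
   forall v : tangent (par0 S),
     (forall (Y : fin_dim_space R) (Theta : par S -> Y),
        admissible_observable adm Theta -> invisible Theta v) <->
     universal_invisible C v).
Proof.
split; [|split; [|split; [|split]]].
- move=> Y Psi Theta PsiS ->.
  have rE := response_comp PsiS.
  split=> //; rewrite -rE; split=> [ker0|inj].
    apply: ker_tdiff_injective => v v0.
    by have : [set 0] v by rewrite -ker0.
  apply/seteqP; split=> v /= v0; last by rewrite v0; exact: tdiff0.
  by apply: inj; rewrite v0; apply/esym/tdiff0.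
(* The universal kernel lies inside a kernel assumed trivial; for a family, inside each member of
   the intersection. *)
- move=> Y Theta ThetaC ker0; apply: ker_tdiff_injective => v v0.
  by have : [set 0] v by rewrite -ker0; exact: universal_invisible_sub v0.
- move=> n Y Theta ThetaC ker0; apply: ker_tdiff_injective => v v0.
  have : [set 0] v; last by [].
  by rewrite -ker0 => i _; exact: universal_invisible_sub (ThetaC i) _ v0.
- by move=> Y Theta ThetaC v; exact: universal_invisible_sub ThetaC v.
(* By contraposition: a nonzero universal response of [v] is separated from 0 by some admissible
   [Psi], and by the chain rule the observable [Psi \o core_map C] then detects [v]. *)
- move=> sep v; split=> [inv|v0 Y Theta [Psi admPsi ->]].
    apply: contrapT => v0.
    have [|Y [Psi [admPsi]]] := sep (universal_response C v) _ v0.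
      by exists v.
    apply; rewrite -[LHS]/((post_diff Psi \o universal_response C) v).
    rewrite -response_comp; last exact: adm_post.
    by apply: inv; exists Psi.
  apply: (universal_invisible_sub _ _ v0).
  by exists Psi => //; exact: adm_post.
Qed.
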